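(* Let the possibility area $X\subseteq\{1,2,\ldots\}$ be discrete, let the true target cell be $x_0\in X$, and let the target distribution be uniform on $X$ (so $X$ is finite and nonempty and $\pi(x)=1/|X|$ for every $x\in X$). Let $E$ be a cumulative effort function, and suppose the detection function $d:X\times\mathbb{R}_+\to[0,1]$ is regular and homogeneous. Let $\varphi^\star$ be the uniformly optimal search plan for the target distribution within $\Phi(E)$. Then $$P[\varphi^\star(\cdot,t)]=P^{\#}[\varphi^\star(\cdot,t)]\quad\text{for all } t\ge 0,$$ and $\mu(\varphi^\star)=\mu^{\#}(\varphi^\star)$.
   Context: Notation: $\mathbb{R}_+=[0,\infty)$. A single stationary target lies in an unknown cell; $x_0$ denotes the true cell. The target distribution is a probability distribution with density (mass function) $\pi$, and its support $X$ is the possibility area. An allocation on $X$ is a function $f:X\to\mathbb{R}_+$; its total effort is $\sum_{x\in X}f(x)$. The cost of an allocation equals its total effort (cost function $c(x,y)=y$). A detection function is a function $d:X\times\mathbb{R}_+\to[0,1]$, where $d(x,y)$ is the conditional probability of detecting the target when effort $y$ is allocated to cell $x$, given that the target is in cell $x$. It is regular if for all $x\in X$ one has $d(x,0)=0$ and $y\mapsto\partial d(x,y)/\partial y$ is continuous, positive and strictly decreasing on $\mathbb{R}_+$ (one-sided derivative at $y=0$). It is homogeneous if $d(x,y)$ does not depend on $x$. For an allocation $f$, the subjective probability of detection is $P[f]=\sum_{x\in X}d(x,f(x))\pi(x)$, and the true probability of detection is $P^{\#}[f]=d(x_0,f(x_0))$. A search plan is a function $\varphi:X\times\mathbb{R}_+\to\mathbb{R}_+$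 such that $\varphi(\cdot,t)$ is an allocation for every $t\ge0$ and $\varphi(x,\cdot)$ is increasing (i.e. nondecreasing) for every $x\in X$. A cumulative effort function is an increasing (nondecreasing) function $E:\mathbb{R}_+\to\mathbb{R}_+$ with $E(t)>0$ for all $t>0$. $\Phi(E)$ is the set of search plans $\varphi$ with $\sum_{x\in X}\varphi(x,t)=E(t)$ for all $t\ge0$. A plan $\varphi^\star\in\Phi(E)$ is uniformly optimal for the target distribution within $\Phi(E)$ if $P[\varphi^\star(\cdot,t)]=\max\{P[\varphi(\cdot,t)]:\varphi\in\Phi(E)\}$ for all $t\ge0$. The subjective and true mean times to detection, as elements of $[0,\infty]$, are $$\mu(\varphi)=\int_0^\infty(1-P[\varphi(\cdot,t)])\,dt,\qquad \mu^{\#}(\varphi)=\int_0^\infty(1-P^{\#}[\varphi(\cdot,t)])\,dt.$$ *)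

(* Defs.v *)
From HB Require Import structures.
From mathcomp Require Import all_boot all_order all_algebra finmap.
From mathcomp Require Import all_classical all_reals all_analysis.

Set Implicit Arguments.
Unset Strict Implicit.
Unset Printing Implicit Defensive.

Import Order.TTheory GRing.Theory Num.Theory.
Import numFieldNormedType.Exports.

Local Open Scope classical_set_scope.
Local Open Scope ring_scope.

(* Functions with an argument in R_+ are functions on R that are constrained
   only on nonnegative arguments; their values elsewhere are irrelevant.
   The possibility area is a finite set of cells, which coerces to the type of
   its elements. *)

Section Search.
Context {R : realType} {X : {fset nat}}.
Implicit Types (pi f : X -> R) (d phi : X -> R -> R) (E : R -> R).

(* Probability mass function with support the whole of X. *)
Definition target_distribution pi : Prop :=
  (forall x, 0 < pi x) /\ \sum_(x : X) pi x = 1.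

Definition uniform_on pi : Prop := forall x, pi x = (#|` X|%:R)^-1.

Definition allocation f : Prop := forall x, 0 <= f x.

Definition detection_function d : Prop :=
  forall x y, 0 <= y -> 0 <= d x y <= 1.

(* g is the derivative of F on [0, +oo[, one-sided at 0. *)
Definition nonneg_derivative (F g : R -> R) : Prop :=
  (forall y : R, 0 < y -> is_derive y 1 F (g y)) /\
  h^-1 * (F h - F 0) @[h --> 0^'+] --> g 0.

Definition regular d : Prop :=
  forall x, d x 0 = 0 /\
    exists g : R -> R,
      [/\ nonneg_derivative (d x) g,
          {within `[0, +oo[, continuous g},
          forall y, 0 <= y -> 0 < g y
        & forall y z, 0 <= y -> y < z -> g z < g y].

Definition homogeneous d : Prop :=
  forall x x' y, 0 <= y -> d x y = d x' y.

Definition subjective_prob d pi f : R := \sum_(x : X) d x (f x) * pi x.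

Definition true_prob d (x0 : X) f : R := d x0 (f x0).

Definition search_plan phi : Prop :=
  (forall t, 0 <= t -> allocation (phi ^~ t)) /\
  (forall x s t, 0 <= s -> s <= t -> phi x s <= phi x t).

Definition cumulative_effort E : Prop :=
  [/\ forall t, 0 <= t -> 0 <= E t,
      forall s t, 0 <= s -> s <= t -> E s <= E t
    & forall t, 0 < t -> 0 < E t].

Definition plans E : set (X -> R -> R) :=
  [set phi | search_plan phi /\
             forall t, 0 <= t -> \sum_(x : X) phi x t = E t].

Definition uniformly_optimal d pi E phi : Prop :=
  plans E phi /\
  forall t, 0 <= t -> forall psi, plans E psi ->
    subjective_prob d pi (psi ^~ t) <= subjective_prob d pi (phi ^~ t).

Definition subjective_mean_time d pi phi : \bar R :=
  \int[lebesgue_measure]_(t in `[0, +oo[)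
    (1 - subjective_prob d pi (phi ^~ t))%:E.

Definition true_mean_time d (x0 : X) phi : \bar R :=
  \int[lebesgue_measure]_(t in `[0, +oo[)
    (1 - true_prob d x0 (phi ^~ t))%:E.

End Search.

(* Main.v *)
Require Import Defs.
From HB Require Import structures.
From mathcomp Require Import all_boot all_order all_algebra finmap.
From mathcomp Require Import all_classical all_reals all_analysis.
From mathcomp Require Import lra.

Set Implicit Arguments.
Unset Strict Implicit.
Unset Printing Implicit Defensive.

Import Order.TTheory GRing.Theory Num.Theory.
Import numFieldNormedType.Exports.

Local Open Scope ring_scope.

(** A detection function that is regular and homogeneous is one function [F],
    strictly concave on the nonnegative reals: its derivative is strictly
    decreasing, so off the point of tangency [F] lies strictly below each of
    its tangent lines ([lt_tangent]).  Summing the tangent-line inequality at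
    the mean effort gives the equality case of Jensen's inequality
    ([jensen_eq]): among the allocations of a given total effort, only the even
    one does as well as the even one.

    Splitting the effort [E t] evenly among the cells is a plan, so a uniformly
    optimal plan does at least as well at each time [t], hence is even at each
    time [t].  All cells, the true one included, then have the same probability
    of detection, which is therefore also its average over the cells; the two
    mean times are integrals of the same function. *)

Section Tangent.
Context {R : realType}.
Implicit Types F g : R -> R.

Lemma nonneg_derivative_cvg0 F g :
  nonneg_derivative F g -> (F h @[h --> 0^'+] --> F 0)%classic.
Proof.
move=> [_ Fg0].
have h0 : (h @[h --> (0 : R)^'+] --> (0 : R))%classic.
  by apply: cvg_at_right_filter; exact: cvg_id.
have lim : (F 0 + h * (h^-1 * (F h - F 0)) @[h --> 0^'+] --> F 0)%classic.
  rewrite -[X in (_ --> X)%classic]addr0 -[X in _ + X](mul0r (g 0)).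
  by apply: cvgD; [exact: cvg_cst|exact: cvgM].
apply: cvg_trans lim; apply: near_eq_cvg.
near=> h.
have h_gt0 : 0 < h by near: h; exact: nbhs_right_gt.
by rewrite /= mulrA divff ?gt_eqF// mul1r addrC subrK.
Unshelve. all: by end_near. Qed.

Lemma nonneg_derivative_MVT F g (a b : R) : nonneg_derivative F g ->
  0 <= a -> a < b ->
  exists2 c, a < c < b & F b - F a = g c * (b - a).
Proof.
move=> Fg a0 ab; have [dF _] := Fg.
have cF (x : R) : 0 < x -> (F y @[y --> x] --> F x)%classic.
  move=> x0; apply: differentiable_continuous; apply/derivable1_diffP.
  by have [] := dF _ x0.
have [||c] := @MVT R F g a b ab.
- by move=> x; rewrite in_itv/= => /andP[ax _]; apply/dF/(le_lt_trans a0).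
- apply/continuous_within_itvP => //; split.
  + by move=> x; rewrite in_itv/= => /andP[ax _]; exact/cF/(le_lt_trans a0).
  + move: a0; rewrite le_eqVlt => /predU1P[<-|a0].
      exact: nonneg_derivative_cvg0 Fg.
    exact/cvg_at_right_filter/cF.
  + exact/cvg_at_left_filter/cF/(le_lt_trans a0).
by rewrite in_itv/= => cab Fab; exists c.
Qed.

Lemma lt_tangent F g (a y : R) : nonneg_derivative F g ->
  (forall u v, 0 <= u -> u < v -> g v < g u) ->
  0 <= a -> 0 <= y -> y != a -> F y < F a + g a * (y - a).
Proof.
move=> Fg gdec a0 y0; rewrite neq_lt => /orP[ya|ay].
  have [c /andP[yc ca] Fay] := nonneg_derivative_MVT Fg y0 ya.
  (* The intermediate slope [g c] is larger than [g a] here, and smaller when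
     [y] is to the right of [a]. *)
  have : g a * (a - y) < g c * (a - y).
    rewrite ltr_pM2r ?subr_gt0//; apply: gdec => //.
    exact/ltW/(le_lt_trans y0).
  by rewrite -Fay; lra.
have [c /andP[ac cy] Fya] := nonneg_derivative_MVT Fg a0 ay.
have : g c * (y - a) < g a * (y - a).
  by rewrite ltr_pM2r ?subr_gt0//; exact: gdec.
by rewrite -Fya; lra.
Qed.

(** The hypothesis on [F] says that the line of slope [s] through the point of
    the graph of [F] at [a] lies, on the nonnegative reals, strictly above the
    graph except at [a]. *)
Lemma jensen_eq (I : finType) F (s a : R) (f : I -> R) :
  (forall y, 0 <= y -> y != a -> F y < F a + s * (y - a)) ->
  (forall i, 0 <= f i) -> \sum_i f i = \sum_(i : I) a ->
  \sum_(i : I) F a <= \sum_i F (f i) -> forall i, f i = a.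
Proof.
move=> tanF f0 fa Ffa i; apply/eqP/negPn/negP => fia.
have tan : \sum_j (F a + s * (f j - a)) = \sum_(j : I) F a.
  by rewrite big_split/= -mulr_sumr sumrB fa subrr mulr0 addr0.
suff : \sum_j F (f j) < \sum_j (F a + s * (f j - a)).
  by rewrite tan ltNge Ffa.
rewrite [ltLHS](bigD1 i)//= [ltRHS](bigD1 i)//=.
apply: ltr_leD; first exact: tanF.
apply: ler_sum => j _; have [->|fja] := eqVneq (f j) a.
  by rewrite subrr mulr0 addr0.
exact/ltW/tanF.
Qed.

End Tangent.

Section EvenPlan.
Context {R : realType} {X : {fset nat}}.
Implicit Types (E : R -> R) (phi : X -> R -> R).

(** The plan that splits the available effort evenly among the cells. *)
Definition even_plan E : X -> R -> R := fun _ t => E t / #|` X|%:R.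

Lemma cells_neq0 (x : X) : #|` X|%:R != 0 :> R.
Proof.
by rewrite pnatr_eq0 cardfs_eq0; apply/fset0Pn; exists (val x); exact: valP.
Qed.

Lemma sum_even_plan E (x : X) (t : R) : \sum_(y : X) even_plan E y t = E t.
Proof.
rewrite sumr_const -cardfE -[LHS]mulr_natr -mulrA mulVf ?mulr1//.
exact: (cells_neq0 x).
Qed.

Lemma even_plan_in_plans E (x : X) :
  cumulative_effort E -> plans E (even_plan E).
Proof.
move=> [E0 Ele _]; split; last by move=> t _; exact: sum_even_plan.
split=> [t t0 y|y u t u0 ut]; first by rewrite divr_ge0// E0.
by rewrite ler_wpM2r ?invr_ge0//; exact: Ele.
Qed.

Lemma subjective_prob_uniform (pi : X -> R) (d : X -> R -> R) (f : X -> R) :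
  uniform_on pi -> homogeneous d -> allocation f ->
  forall x, subjective_prob d pi f = (\sum_(y : X) d x (f y)) / #|` X|%:R.
Proof.
move=> hunif hhom f0 x; rewrite mulr_suml; apply: eq_bigr => y _.
by rewrite hunif (hhom y x).
Qed.

(** Only the even plan can be uniformly optimal, since it is itself among the
    plans that a uniformly optimal one must equal or surpass. *)
Lemma uniformly_optimal_even (pi : X -> R) E (d : X -> R -> R) phi :
  uniform_on pi -> cumulative_effort E -> regular d -> homogeneous d ->
  uniformly_optimal d pi E phi ->
  forall t, 0 <= t -> forall x, phi x t = even_plan E x t.
Proof.
move=> hunif hE hreg hhom [[[phi0 _] sumphi] opt] t t0 x.
have [_ [g [Fg _ _ gdec]]] := hreg x.
have a0 : 0 <= even_plan E x t by rewrite divr_ge0//; case: hE => + _ _; apply.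
apply: (jensen_eq (fun y => lt_tangent Fg gdec a0) (phi0 _ t0)) => /=.
  by rewrite sumphi// -[LHS](sum_even_plan E x).
have := opt t t0 _ (even_plan_in_plans x hE).
rewrite (subjective_prob_uniform hunif hhom (fun=> a0) x).
rewrite (subjective_prob_uniform hunif hhom (phi0 t t0) x).
by rewrite ler_pM2r// invr_gt0 lt0r (cells_neq0 x)/=.
Qed.

End EvenPlan.

Theorem theorem3p1 (R : realType) (X : {fset nat})
    (hX : forall n : nat, n \in X -> (0 < n)%N)
    (x0 : X)
    (pi : X -> R) (hpi : target_distribution pi) (hunif : uniform_on pi)
    (E : R -> R) (hE : cumulative_effort E)
    (d : X -> R -> R) (hd : detection_function d)
    (hreg : regular d) (hhom : homogeneous d)
    (phi : X -> R -> R) (hphi : uniformly_optimal d pi E phi) :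
  (forall t : R, 0 <= t ->
     subjective_prob d pi (phi ^~ t) = true_prob d x0 (phi ^~ t)) /\
  subjective_mean_time d pi phi = true_mean_time d x0 phi.
Proof.
have prob_eq t : 0 <= t ->
    subjective_prob d pi (phi ^~ t) = true_prob d x0 (phi ^~ t).
  move=> t0; have even := uniformly_optimal_even hunif hE hreg hhom hphi t0.
  have phi0 : 0 <= phi x0 t by have [[[+ _] _] _] := hphi; apply.
  rewrite /subjective_prob /true_prob.
  transitivity (\sum_(x : X) d x0 (phi x0 t) * pi x).
    apply: eq_bigr => x _.
    by rewrite [phi x t]even -[even_plan E x t](even x0) (hhom x x0).
  by rewrite -mulr_sumr; case: hpi => _ ->; rewrite mulr1.
split=> //; apply: eq_integral => t.
by rewrite inE/= in_itv/= andbT => t0; rewrite prob_eq.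
Qed.
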